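(* Let $m,n,p\ge 1$, let $A_k\in\mathbb{R}_{\max}^{m\times m}$ and $B_k\in\mathbb{R}_{\max}^{n\times n}$ for $k=1,\dots,p$, and let $C\in\mathbb{R}_{\max}^{m\times n}$. Consider the max-plus Sylvester equation $$\bigoplus_{k=1}^{p} A_k\otimes X\otimes B_k = C$$ in the unknown $X\in\mathbb{R}_{\max}^{m\times n}$. Its principal solution $X^*$ is given by $$X^*=\mathop{{\bigoplus}'}_{k=1}^{p}\ A_k^\sharp\otimes' C\otimes' B_k^\sharp,$$ and the equation is solvable if and only if $X^*$ is a solution, i.e. if and only if $\bigoplus_{k=1}^{p} A_k\otimes X^*\otimes B_k = C$. Moreover, $X^*$ can be calculated, and whether it is a solution can be verified, with a time complexity of $O(p(m^2n+mn^2))$.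
   Context: $\mathbb{R}_{\max}=\mathbb{R}\cup\{-\infty\}$ with the operations $a\oplus b=\max\{a,b\}$ and $a\otimes b=a+b$ (max-plus algebra); $\mathbb{R}_{\min}=\mathbb{R}\cup\{+\infty\}$ with $a\oplus' b=\min\{a,b\}$ and $a\otimes' b=a+b$ (min-plus algebra). Both pairs extend to matrices and vectors as in linear algebra: $\oplus,\oplus'$ act entrywise, $(A\otimes B)_{ij}=\max_k(a_{ik}+b_{kj})$, and $(A\otimes' B)_{ij}=\min_k(a_{ik}+b_{kj})$; $\bigoplus$ and $\bigoplus'$ denote iterated $\oplus$ and $\oplus'$, i.e. entrywise maximum and entrywise minimum. When infinities of both signs occur, matrices are regarded as having entries in $\mathbb{R}\cup\{-\infty,+\infty\}$, with the conventions $(-\infty)\otimes(+\infty)=(+\infty)\otimes(-\infty)=-\infty$ and $(-\infty)\otimes'(+\infty)=(+\infty)\otimes'(-\infty)=+\infty$. The conjugate of a matrix $A=(a_{ij})$ is $A^\sharp=-A^T$, i.e. $(A^\sharp)_{ij}=-a_{ji}$, with $-(-\infty)=+\infty$. The equation is solvable if some $X\in\mathbb{R}_{\max}^{m\times n}$ satisfies it. ''$X^*$ is a solution'' means that $X^*$ satisfies the equation (under the conventions $(-\infty)\otimes(+\infty)=(+\infty)\otimes(-\infty)=-\infty$ and $(-\infty)\otimes'(+\infty)=(+\infty)\otimes'(-\infty)=+\infty$ if $X^*$ has entries equal to $+\infty$). The max-plus Kronecker product $P\boxtimes Q$ is the block matrix whose $(i,j)$ block is $p_{ij}\otimes Q$.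 The operator $\mathrm{vec}(\cdot)$ transforms a matrix into a vector by stacking its columns one underneath the other. The principal solution of a max-plus linear system $M\otimes\mathbf{x}=\mathbf{b}$ is $\mathbf{x}^*=M^\sharp\otimes'\mathbf{b}$. The Sylvester equation is equivalent to the max-plus linear system $\left(\bigoplus_{k=1}^p B_k^T\boxtimes A_k\right)\otimes\mathrm{vec}(X)=\mathrm{vec}(C)$, and its principal solution is the matrix $X^*$ defined by $\mathrm{vec}(X^* )=\left(\bigoplus_{k=1}^p B_k^T\boxtimes A_k\right)^\sharp\otimes'\mathrm{vec}(C)$. Time complexity is counted as the number of elementary scalar operations (additions, negations, comparisons, maxima and minima of two elements of $\mathbb{R}\cup\{-\infty,+\infty\}$). *)

(* Defs.v *)
From HB Require Import structures.
From mathcomp Require Import all_boot all_order all_algebra.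
From mathcomp Require Import reals constructive_ereal.

Set Implicit Arguments.
Unset Strict Implicit.
Unset Printing Implicit Defensive.

Import Order.TTheory GRing.Theory Num.Theory.
Local Open Scope ring_scope.

Declare Scope maxplus_scope.
Delimit Scope maxplus_scope with MP.

Section MaxPlus.
Context {R : realType}.
Implicit Types x y : \bar R.

(* The library's two additions on \bar R follow the two conventions for
   opposite infinities: -oo + +oo = -oo in %E and -oo + +oo = +oo in %dE. *)
Definition otimes x y : \bar R := (x + y)%E.
Definition otimes' x y : \bar R := (x + y)%dE.

Lemma otimesNP : otimes -oo +oo = -oo%E /\ otimes +oo -oo = -oo%E.
Proof. by []. Qed.

Lemma otimes'NP : otimes' -oo +oo = +oo%E /\ otimes' +oo -oo = +oo%E.
Proof. by []. Qed.

(* The entries lie in R_max, i.e. differ from +oo. *)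
Definition Rmax_mx a b (A : 'M[\bar R]_(a, b)) : Prop :=
  forall i j, A i j != +oo%E.

Definition mulmp a b c (A : 'M[\bar R]_(a, b)) (B : 'M[\bar R]_(b, c)) :
    'M[\bar R]_(a, c) :=
  \matrix_(i, j) \big[maxe/-oo%E]_(k < b) otimes (A i k) (B k j).

Definition mulmp' a b c (A : 'M[\bar R]_(a, b)) (B : 'M[\bar R]_(b, c)) :
    'M[\bar R]_(a, c) :=
  \matrix_(i, j) \big[mine/+oo%E]_(k < b) otimes' (A i k) (B k j).

Definition bigoplus a b p (F : 'I_p -> 'M[\bar R]_(a, b)) : 'M[\bar R]_(a, b) :=
  \matrix_(i, j) \big[maxe/-oo%E]_(k < p) F k i j.

Definition bigoplus' a b p (F : 'I_p -> 'M[\bar R]_(a, b)) : 'M[\bar R]_(a, b) :=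
  \matrix_(i, j) \big[mine/+oo%E]_(k < p) F k i j.

Definition conjmp a b (A : 'M[\bar R]_(a, b)) : 'M[\bar R]_(b, a) :=
  \matrix_(i, j) (- A j i)%E.

Definition kronmp a b c d (P : 'M[\bar R]_(a, b)) (Q : 'M[\bar R]_(c, d)) :
    'M[\bar R]_(\sum_(i < a) c, \sum_(j < b) d) :=
  \mxblock_(i < a, j < b) map_mx (otimes (P i j)) Q.

Definition vec m n (X : 'M[\bar R]_(m, n)) : 'cV[\bar R]_(\sum_(j < n) m) :=
  \mxcol_(j < n) col j X.

Definition unvec m n (v : 'cV[\bar R]_(\sum_(j < n) m)) : 'M[\bar R]_(m, n) :=
  \matrix_(i, j) submxcol v j i 0.

Lemma vecK m n : cancel (@vec m n) (@unvec m n).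
Proof. by move=> X; apply/matrixP => i j; rewrite mxE mxcolK mxE. Qed.

Lemma unvecK m n : cancel (@unvec m n) (@vec m n).
Proof.
move=> v; rewrite -[RHS]submxcolK; apply/eq_mxcol => j; apply/matrixP => i k.
by rewrite !mxE (ord1 k).
Qed.

(* The principal solution of the linear system M ⊗ x = v. *)
Definition principal_solution a b (M : 'M[\bar R]_(a, b)) (v : 'cV[\bar R]_a) :
    'cV[\bar R]_b :=
  mulmp' (conjmp M) v.

End MaxPlus.

Notation "A ⊗ B" := (mulmp A B) (at level 40, left associativity) : maxplus_scope.
Notation "A ⊗' B" := (mulmp' A B) (at level 40, left associativity) : maxplus_scope.
Notation "P ⊠ Q" := (kronmp P Q) (at level 40, left associativity) : maxplus_scope.
Notation "A ^♯" := (conjmp A) (at level 2, format "A ^♯") : maxplus_scope.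

Section Sylvester.
Local Open Scope maxplus_scope.
Context {R : realType} {m n p : nat}.
Variables (A : 'I_p -> 'M[\bar R]_m) (B : 'I_p -> 'M[\bar R]_n).
Variable C : 'M[\bar R]_(m, n).

Definition sylvester_eq (X : 'M[\bar R]_(m, n)) : Prop :=
  bigoplus (fun k => A k ⊗ X ⊗ B k) = C.

Definition sylvester_solvable : Prop :=
  exists X : 'M[\bar R]_(m, n), Rmax_mx X /\ sylvester_eq X.

Definition sylvester_matrix : 'M[\bar R]_(\sum_(j < n) m) :=
  bigoplus (fun k => (B k)^T ⊠ A k).

(* The X whose vec is the principal solution of the vectorized system;
   unvec is the inverse of vec by vecK and unvecK. *)
Definition sylvester_principal : 'M[\bar R]_(m, n) :=
  unvec (principal_solution sylvester_matrix (vec C)).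

End Sylvester.

(* Model of computation: programs with nested loops over {0, ..., m-1},
   {0, ..., n-1} and {0, ..., p-1}, acting on arrays of elements of \bar R.
   The syntax mentions neither the dimensions nor the data, so that one program
   serves all sizes and inputs.  Scalars can be inspected only by CIfLe.
   Additions, negations, maxima, minima and comparisons cost 1 each; reading
   or copying a cell, the literals -oo and +oo and loop control are free. *)
Inductive dim := DimM | DimN | DimP.

Inductive binop := OAdd | OAdd' | OMax | OMin.

(* ECell a idx denotes the cell of array a whose indices are the current values
   of the loop variables listed in idx. *)
Inductive expr :=
  | ENinfty
  | EPinfty
  | ECell of nat & seq nat
  | EOpp of expr
  | EBin of binop & expr & expr.

Inductive cmd :=
  | CSkip
  | CSeq of cmd & cmd
  | CAssign of nat & seq nat & expr
  | CVerdict of bool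
  | CIfLe of expr & expr & cmd & cmd
  | CFor of nat & dim & cmd.

Section Semantics.
Context {R : realType}.

Definition memory : Type := nat -> seq nat -> \bar R.

Record state := State { cells : memory; verdict : bool; ops : nat }.

Definition write (a : nat) (js : seq nat) (v : \bar R) (M : memory) : memory :=
  fun b ks => if (b == a) && (ks == js) then v else M b ks.

Definition tick (c : nat) (s : state) : state :=
  State (cells s) (verdict s) (ops s + c).

Definition eval_binop (o : binop) (x y : \bar R) : \bar R :=
  match o with
  | OAdd => otimes x y
  | OAdd' => otimes' x y
  | OMax => maxe x y
  | OMin => mine x y
  end.

Fixpoint eval (env : nat -> nat) (M : memory) (e : expr) : \bar R :=
  match e with
  | ENinfty => -oo%E
  | EPinfty => +oo%E
  | ECell a idx => M a (map env idx)
  | EOpp e1 => (- eval env M e1)%E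
  | EBin o e1 e2 => eval_binop o (eval env M e1) (eval env M e2)
  end.

Fixpoint expr_cost (e : expr) : nat :=
  match e with
  | ENinfty | EPinfty | ECell _ _ => 0
  | EOpp e1 => (expr_cost e1).+1
  | EBin _ e1 e2 => (expr_cost e1 + expr_cost e2).+1
  end.

Fixpoint exec (size_of : dim -> nat) (env : nat -> nat) (c : cmd) (s : state) :
    state :=
  match c with
  | CSkip => s
  | CSeq c1 c2 => exec size_of env c2 (exec size_of env c1 s)
  | CAssign a idx e =>
      tick (expr_cost e)
        (State (write a (map env idx) (eval env (cells s) e) (cells s))
               (verdict s) (ops s))
  | CVerdict b => State (cells s) b (ops s)
  | CIfLe e1 e2 c1 c2 =>
      exec size_of env
        (if (eval env (cells s) e1 <= eval env (cells s) e2)%E then c1 else c2)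
        (tick (expr_cost e1 + expr_cost e2).+1 s)
  | CFor i d c1 =>
      foldl (fun s k => exec size_of (fun j => if j == i then k else env j) c1 s)
            s (iota 0 (size_of d))
  end.

Definition size_of (m n p : nat) (d : dim) : nat :=
  match d with DimM => m | DimN => n | DimP => p end.

Definition run (m n p : nat) (c : cmd) (M : memory) : state :=
  exec (size_of m n p) (fun=> 0%N) c (State M false 0).

Definition holds_mx a b (X : 'M[\bar R]_(a, b)) (arr : nat) (pre : seq nat)
    (M : memory) : Prop :=
  forall (i : 'I_a) (j : 'I_b), M arr (rcons (rcons pre i) j) = X i j.

(* Array 0 holds A_k at indices [:: k; i; j], array 1 holds B_k likewise, and
   array 2 holds C at [:: i; j]; the rest of the memory is arbitrary. *)
Definition holds_input m n p (A : 'I_p -> 'M[\bar R]_m)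
    (B : 'I_p -> 'M[\bar R]_n) (C : 'M[\bar R]_(m, n)) (M : memory) : Prop :=
  [/\ forall k : 'I_p, holds_mx (A k) 0 [:: val k] M,
      forall k : 'I_p, holds_mx (B k) 1 [:: val k] M
    & holds_mx C 2 [::] M].

(* Array 3 receives the computed matrix. *)
Definition holds_output m n (X : 'M[\bar R]_(m, n)) (M : memory) : Prop :=
  holds_mx X 3 [::] M.

End Semantics.

(* Main.v *)
Require Import Defs.
From mathcomp Require Import all_boot all_order all_algebra.
From mathcomp Require Import reals constructive_ereal.
From mathcomp Require Import zify.

Set Implicit Arguments.
Unset Strict Implicit.
Unset Printing Implicit Defensive.

Import Order.TTheory GRing.Theory Num.Theory DualAddTheory.

(** Everything follows from one residuation law: with the two conventions for
    opposite infinities, x ⊗ y <= z is equivalent to y <= (-x) ⊗' z for all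
    extended reals, infinite ones included ([residuation]).  Hence
    F(X) = ⊕_k A_k ⊗ X ⊗ B_k satisfies F(X) <= C exactly when every entry
    satisfies a_ri ⊗ x_ij ⊗ b_jl <= c_rl for all k, r, l
    ([bounded_contribution]).  This is an upper bound on each x_ij separately,
    and both the closed form ⊕'_k A_k^♯ ⊗' C ⊗' B_k^♯ and the principal
    solution of the vectorized system compute the largest x_ij that meets it.
    They therefore coincide, and the common value X* makes F(X) <= C equivalent
    to X <= X* ([sylvester_op_adjoint]), a Galois connection.

    If X solves the equation then X <= X*, so C = F(X) <= F(X* ) <= C and X*
    satisfies it.  Conversely X* may have entries +oo, but F(X* ) <= C < +oo
    forces each of them to meet only products a_ri ⊗ b_jl equal to -oo, so
    lowering these entries to -oo leaves F(X* ) unchanged and gives a solution in R_max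
    ([sylvester_op_cap_pinfty]).

    For the complexity, both ⊕'_k (A_k^♯ ⊗' C) ⊗' B_k^♯ and
    ⊕_k (A_k ⊗ X* ) ⊗ B_k are sums of triple products over a monoid.  One
    program ([triple_sum]) evaluates such a sum, forming for each k the m by n
    product of the first two factors in a work array, with m terms per entry,
    and then multiplying it by the third factor, with n terms per entry; this
    takes O(p (m^2 n + m n^2)) operations.  Running it once in each semiring and
    comparing the outcome with C is the whole algorithm ([sylvester_algorithm],
    [run_sylvester_algorithm]). *)

(** * Residuation in the extended reals *)
Local Open Scope maxplus_scope.

Section Residuation.
Context {R : realType}.
Implicit Types x y z : \bar R.

Lemma otimesC : commutative (@otimes R).
Proof. exact: addeC. Qed.

Lemma otimesA : associative (@otimes R).
Proof. exact: addeA. Qed.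

Lemma otimes'C : commutative (@otimes' R).
Proof. exact: daddeC. Qed.

Lemma otimes_rot x y z : otimes (otimes x y) z = otimes y (otimes z x).
Proof. by rewrite (otimesC x) -otimesA (otimesC x). Qed.

(** When x and z are finite this is x + y <= z iff y <= z - x.  For infinite x
    or z it is the difference between the two conventions that keeps it true:
    -oo ⊗ (+oo) is -oo, and (+oo) ⊗' (-oo) is +oo. *)
Lemma residuation x y z : (otimes x y <= z)%E = (y <= otimes' (- x) z)%E.
Proof.
rewrite /otimes /otimes'.
case: x y z => [x||] [y||] [z||] //; rewrite ?leey ?leNye //.
by rewrite -EFinN -EFinD -dEFinD !lee_fin [in RHS]addrC lerBrDl.
Qed.

Lemma le_bigmineP n (F : 'I_n -> \bar R) x :
  (x <= \big[mine/+oo]_(i < n) F i)%E <-> forall i, (x <= F i)%E.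
Proof.
split=> [/bigmin_geP[_ h] i|h]; first exact: h.
by apply/bigmin_geP; split=> [|i _]; [exact: leey|exact: h].
Qed.

Lemma bigmaxe_leP n (F : 'I_n -> \bar R) x :
  (\big[maxe/-oo]_(i < n) F i <= x)%E <-> forall i, (F i <= x)%E.
Proof.
split=> [/bigmax_leP[_ h] i|h]; first exact: h.
by apply/bigmax_leP; split=> [|i _]; [exact: leNye|exact: h].
Qed.

End Residuation.

(** * The Sylvester operator and its residual *)

Section SylvesterTheory.
Context {R : realType} {m n p : nat}.
Variables (A : 'I_p -> 'M[\bar R]_m) (B : 'I_p -> 'M[\bar R]_n).
Implicit Types (C X Y Z : 'M[\bar R]_(m, n)) (y : \bar R).

Definition sylvester_op X := bigoplus (fun k => A k ⊗ X ⊗ B k).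

Definition sylvester_residual C := bigoplus' (fun k => (A k)^♯ ⊗' C ⊗' (B k)^♯).

(** The part of F(X) <= C that concerns the entry y = x_ij.  It involves no other
    entry of X, so that F(X) <= C decouples into one upper bound per entry. *)
Definition bounded_contribution C i j y :=
  forall k r l, (otimes (otimes (A k r i) y) (B k j l) <= C r l)%E.

Lemma sylvester_op_leP X C :
  (forall r l, (sylvester_op X r l <= C r l)%E) <->
  (forall i j, bounded_contribution C i j (X i j)).
Proof.
split=> [h i j k r l|h r l].
  move: (h r l); rewrite mxE => /bigmaxe_leP/(_ k).
  rewrite mxE => /bigmaxe_leP/(_ j).
  rewrite otimesC residuation mxE => /bigmaxe_leP/(_ i).
  by rewrite -residuation otimesC.
rewrite mxE; apply/bigmaxe_leP => k; rewrite mxE; apply/bigmaxe_leP => j.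
rewrite otimesC residuation mxE; apply/bigmaxe_leP => i.
by rewrite -residuation otimesC; exact: h.
Qed.

(** Residuating twice moves A_k and B_k back to the left of the inequality; the
    order in which this is done corresponds to the bracketing of the product. *)
Lemma le_sylvester_residualP C i j y :
  (y <= sylvester_residual C i j)%E <-> bounded_contribution C i j y.
Proof.
have E k r l : otimes (otimes (A k r i) y) (B k j l) =
    otimes (A k r i) (otimes (B k j l) y).
  by rewrite -otimesA (otimesC y).
split=> [h k r l|h].
  move: h; rewrite E mxE => /le_bigmineP/(_ k).
  rewrite mxE => /le_bigmineP/(_ l).
  rewrite [(B k)^♯ _ _]mxE otimes'C -residuation mxE => /le_bigmineP/(_ r).
  by rewrite [(A k)^♯ _ _]mxE -residuation.
rewrite mxE; apply/le_bigmineP => k; rewrite mxE; apply/le_bigmineP => l.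
rewrite [(B k)^♯ _ _]mxE otimes'C -residuation mxE.
apply/le_bigmineP => r.
by rewrite [(A k)^♯ _ _]mxE -residuation -E; exact: h.
Qed.

(** In blocks of constant size the offset of an index has a type that does not
    mention the block, so [tagnat.Rank2K] holds here without its cast. *)
Lemma sig2_Rank (j : 'I_n) (i : 'I_m) :
  tagnat.sig2 (tagnat.Rank j i : 'I_(\sum_(l < n) m)) = i :> 'I_m.
Proof. by apply: val_inj; rewrite tagnat.Rank2K. Qed.

(** Columns of the Kronecker matrix are indexed by the pair (j, i) of a column
    and a row of X, its rows by a column [sig1 q] and a row [sig2 q] of C. *)
Lemma sylvester_matrixE q j i :
  sylvester_matrix A B q (tagnat.Rank j i) =
  \big[maxe/-oo%E]_(k < p)
    otimes (B k j (tagnat.sig1 q)) (A k (tagnat.sig2 q) i).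
Proof.
rewrite mxE; apply: eq_bigr => k _.
by rewrite !mxE tagnat.Rank1K sig2_Rank.
Qed.

Lemma le_sylvester_principalP C i j y :
  (y <= sylvester_principal A B C i j)%E <-> bounded_contribution C i j y.
Proof.
have E q : (y <= otimes' (- sylvester_matrix A B q (tagnat.Rank j i)) (vec C q 0%R))%E <->
    forall k, (otimes (otimes (A k (tagnat.sig2 q) i) y) (B k j (tagnat.sig1 q))
       <= C (tagnat.sig2 q) (tagnat.sig1 q))%E.
  rewrite -residuation sylvester_matrixE otimesC residuation !mxE.
  split=> [/bigmaxe_leP h k|h]; last (apply/bigmaxe_leP => k).
    by rewrite otimes_rot residuation; exact: h.
  by rewrite -residuation -otimes_rot; exact: h.
rewrite !mxE; split=> [/le_bigmineP h k r l|h]; last first.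
  by apply/le_bigmineP => q; rewrite mxE; apply/E => k; exact: h.
have := h (tagnat.Rank l r); rewrite mxE => /E/(_ k).
by rewrite sig2_Rank tagnat.Rank1K.
Qed.

(** Both sides have the same lower bounds, entry by entry; this replaces
    distributing ⊗' over minima and reindexing the vectorized minimum. *)
Lemma sylvester_principalE C :
  sylvester_principal A B C = sylvester_residual C.
Proof.
apply/matrixP => i j; apply: le_anti; apply/andP; split.
  by apply/le_sylvester_residualP/le_sylvester_principalP.
by apply/le_sylvester_principalP/le_sylvester_residualP.
Qed.

(** The residual is the upper adjoint of F for the entrywise order. *)
Lemma sylvester_op_adjoint X C :
  (forall r l, (sylvester_op X r l <= C r l)%E) <->
  (forall i j, (X i j <= sylvester_residual C i j)%E).
Proof.
split=> [/sylvester_op_leP h i j|h]; first by apply/le_sylvester_residualP.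
by apply/sylvester_op_leP => i j; apply/le_sylvester_residualP.
Qed.

(** As for any left adjoint, monotonicity follows from the connection alone:
    X <= Y <= (F(Y))*. *)
Lemma sylvester_op_mono X Y : (forall i j, (X i j <= Y i j)%E) ->
  forall r l, (sylvester_op X r l <= sylvester_op Y r l)%E.
Proof.
move=> leXY; apply/sylvester_op_adjoint => i j.
apply: le_trans (leXY i j) _.
by apply: (sylvester_op_adjoint Y (sylvester_op Y)).1.
Qed.

(** An entry +oo becomes -oo, the neutral element of ⊕; any value of R_max would
    serve, but this one makes the result smaller than X. *)
Definition cap_pinfty X : 'M[\bar R]_(m, n) :=
  \matrix_(i, j) (if X i j == +oo%E then -oo%E else X i j).

Lemma Rmax_cap_pinfty X : Rmax_mx (cap_pinfty X).
Proof. by move=> i j; rewrite mxE; case: ifPn. Qed.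

(** If x_ij = +oo then a_ri ⊗ x_ij ⊗ b_jl is -oo or +oo, and the bound c_rl < +oo
    excludes the latter, so such an entry contributes nothing to F(X). *)
Lemma sylvester_op_cap_pinfty X C : Rmax_mx C ->
  (forall r l, (sylvester_op X r l <= C r l)%E) ->
  sylvester_op (cap_pinfty X) = sylvester_op X.
Proof.
move=> finC /sylvester_op_leP leXC.
apply/matrixP => r l; apply: le_anti; apply/andP; split.
  by apply: sylvester_op_mono => i j; rewrite mxE; case: ifP => // _; exact: leNye.
move: r l; apply/sylvester_op_leP => i j k r l.
(* F(X) <= F(X') is proved term by term; away from +oo the terms of F(X) are
   terms of F(X'). *)
have := (sylvester_op_leP (cap_pinfty X) (sylvester_op (cap_pinfty X))).1.
move=> /(_ (fun _ _ => lexx _)) /(_ i j k r l); rewrite [cap_pinfty X i j]mxE.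
case: eqP => // Xoo _; have := leXC i j k r l; rewrite Xoo.
have := finC r l.
case: (C r l) => [c||] //; case: (A k r i) => [a||]; case: (B k j l) => [b||] //= _;
  rewrite /otimes /= ?leye_eq // => _; exact: leNye.
Qed.

Lemma sylvester_solvableP C : Rmax_mx C ->
  sylvester_solvable A B C <-> sylvester_eq A B C (sylvester_principal A B C).
Proof.
rewrite sylvester_principalE => finC.
have sub r l : (sylvester_op (sylvester_residual C) r l <= C r l)%E.
  by move: r l; apply/sylvester_op_adjoint.
split=> [[X [_ solX]]|sol].
  apply/matrixP => r l; apply: le_anti; rewrite sub /=.
  rewrite -[in X in (X <= _)%O]solX.
  apply: sylvester_op_mono; apply/sylvester_op_adjoint => i j.
  by rewrite -[in leRHS]solX.
exists (cap_pinfty (sylvester_residual C)); split; first exact: Rmax_cap_pinfty.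
by rewrite /sylvester_eq -/(sylvester_op _) (sylvester_op_cap_pinfty finC sub).
Qed.

End SylvesterTheory.

(** * The algorithm *)

(** Throughout, loop variable 0 is the index k of the coefficients, variables 1
    and 2 are the row and the column of the entry under construction, and
    variable 3 is the summation index. *)
Definition entry_loop (c : cmd) : cmd := CFor 1 DimM (CFor 2 DimN c).

Definition add_terms (o : binop) (T : nat) (d : Defs.dim) (e : expr) : cmd :=
  CFor 3 d (CAssign T [:: 1; 2] (EBin o (ECell T [:: 1; 2]) e)).

(** Array 4 is the work array.  It receives the product of the factors [el] and
    [mid] before [er] is applied: this intermediate product is what avoids the
    m^2 n^2 terms of the triple product. *)
Definition triple_sum (oacc omul : binop) (lit el : expr) (mid : nat)
    (er : expr) (dst : nat) : cmd :=
  CSeq (entry_loop (CAssign dst [:: 1; 2] lit))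
    (CFor 0 DimP
      (CSeq (entry_loop (CAssign 4 [:: 1; 2] lit))
        (CSeq (entry_loop (add_terms oacc 4 DimM
                 (EBin omul el (ECell mid [:: 3; 2]))))
              (entry_loop (add_terms oacc dst DimN
                 (EBin omul (ECell 4 [:: 1; 3]) er)))))).

Definition compare_arrays (a b : nat) : cmd :=
  let x := ECell a [:: 1; 2] in let y := ECell b [:: 1; 2] in
  CSeq (CVerdict true)
    (entry_loop
      (CIfLe x y (CIfLe y x CSkip (CVerdict false)) (CVerdict false))).

(** The conjugates A_k^♯ and B_k^♯ are not stored: they are read from the arrays
    of A_k and B_k with exchanged indices and a change of sign.  Array 3 receives
    X* and array 5 receives F(X* ). *)
Definition sylvester_algorithm : cmd :=
  CSeq (triple_sum OMin OAdd' EPinfty (EOpp (ECell 0 [:: 0; 3; 1])) 2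
          (EOpp (ECell 1 [:: 0; 2; 3])) 3)
  (CSeq (triple_sum OMax OAdd ENinfty (ECell 0 [:: 0; 1; 3]) 3
          (ECell 1 [:: 0; 3; 2]) 5)
        (compare_arrays 5 2)).

(** * Semantics of the loops *)

Lemma foldl_iota_ind (S : Type) (f : S -> nat -> S) (I : nat -> S -> Prop) n s :
  I 0 s -> (forall k t, k < n -> I k t -> I k.+1 (f t k)) ->
  I n (foldl f s (iota 0 n)).
Proof.
elim: n => [|n IHn] // I0 IS; rewrite -addn1 iotaD foldl_cat /= addn1.
by apply: (IS) => //; apply: IHn => // k t ltkn; apply: IS; exact: ltnW.
Qed.

Section Programs.
Context {R : realType}.
Variable sz : Defs.dim -> nat.
Implicit Types (s t u : @state R) (M : @memory R) (env : nat -> nat)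
  (D : nat -> seq nat -> bool).

Definition upd env i k : nat -> nat := fun j => if j == i then k else env j.

(** D is a predicate on cells, and not only on arrays, because the iterations of
    a loop over entries fill different cells of the same array. *)
Definition writes_only (D : nat -> seq nat -> bool) (c : nat) s t : Prop :=
  [/\ forall a js, ~~ D a js -> cells t a js = cells s a js,
      verdict t = verdict s
    & ops t = ops s + c].

Lemma writes_only_refl D s : writes_only D 0 s s.
Proof. by split; rewrite ?addn0. Qed.

Lemma writes_only_trans D c c' s t u :
  writes_only D c s t -> writes_only D c' t u -> writes_only D (c + c') s u.
Proof.
move=> [st vst ost] [tu vtu otu]; split=> [a js Djs||].
- by rewrite tu // st.
- by rewrite vtu.
by rewrite otu ost addnA.
Qed.

Lemma writes_only_sub D (D' : nat -> seq nat -> bool) c s t :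
  (forall a js, D a js -> D' a js) ->
  writes_only D c s t -> writes_only D' c s t.
Proof.
move=> sub [st vst ost]; split=> // a js D'F; apply: st.
by apply: contra D'F; exact: sub.
Qed.

(** If the body at (i, j) changes only the cell [i; j] of T, then no iteration
    disturbs another, and every cell is updated once from its initial value.
    The other arrays are constant during the loop, which is why the body is
    examined only in states t that agree with s outside T. *)
Lemma exec_entry_loop env c s T k (g : nat -> nat -> \bar R -> \bar R) :
  (forall i j t, i < sz DimM -> j < sz DimN ->
     (forall a js, a != T -> cells t a js = cells s a js) ->
     let u := exec sz (upd (upd env 1 i) 2 j) c t in
     writes_only (fun a js => (a == T) && (js == [:: i; j])) k t u /\
     cells u T [:: i; j] = g i j (cells t T [:: i; j])) ->
  let t := exec sz env (entry_loop c) s in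
  writes_only (fun a _ => a == T) (sz DimM * sz DimN * k) s t /\
  (forall i j, i < sz DimM -> j < sz DimN ->
     cells t T [:: i; j] = g i j (cells s T [:: i; j])).
Proof.
move=> hc.
(* The cells (a, b) already processed when iteration (i, j) begins. *)
pose processed i j a b := (a < i) || ((a == i) && (b < j)).
pose Inv i j t :=
  writes_only (fun a _ => a == T) ((i * sz DimN + j) * k) s t /\
  (forall a b, a < sz DimM -> b < sz DimN ->
     cells t T [:: a; b] =
     if processed i j a b then g a b (cells s T [:: a; b])
     else cells s T [:: a; b]).
suff [w h] : Inv (sz DimM) 0 (exec sz env (entry_loop c) s).
  split=> [|i j ltiM ltjN]; first by rewrite addn0 in w.
  by rewrite h // /processed ltiM.
apply: (foldl_iota_ind (I := fun i t => Inv i 0 t)).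
  split=> [|a b _ _]; first exact: writes_only_refl.
  by rewrite /processed !ltn0 andbF.
move=> i t ltiM It.
suff [w h] : Inv i (sz DimN) (exec sz (upd env 1 i) (CFor 2 DimN c) t).
  split=> [|a b ltaM ltbN]; first by rewrite mulSn addn0 addnC.
  rewrite -/(exec sz (upd env 1 i) (CFor 2 DimN c) t) h // /processed ltbN ltn0.
  by rewrite andbT andbF orbF ltnS [a <= i]leq_eqVlt orbC.
apply: (foldl_iota_ind (I := fun j t => Inv i j t)) => // j u ltjN [wu hu].
have agree a js : a != T -> cells u a js = cells s a js.
  by case: wu => h _ _; exact: h.
have [wv hv] := hc i j u ltiM ltjN agree.
split=> [|a b ltaM ltbN].
  rewrite addnS mulSn addnC; apply: (writes_only_trans wu).
  by apply: writes_only_sub wv => a js /andP[].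
have [[-> ->]|neq] := eqVneq (a, b) (i, j).
  by rewrite hv hu // /processed !ltnn !eqxx /= ltnSn.
have -> : cells (exec sz (upd (upd env 1 i) 2 j) c u) T [:: a; b] = cells u T [:: a; b].
  case: wv => h _ _; apply: h; apply: contra neq.
  by rewrite eqxx /= => /eqP[-> ->].
rewrite hu //; congr (if _ then _ else _).
rewrite /processed ltnS [b <= j]leq_eqVlt; move: neq; rewrite xpair_eqE.
by case: eqP => //= _; case: eqP.
Qed.

(** Only the monoid structure of the iterated operation matters, so that the
    programs for the min-plus and the max-plus product are analysed together. *)
Section Semiring.
Variables (idx : \bar R) (op : Monoid.law idx) (oacc omul : binop) (lit : expr).
Hypothesis evalacc : forall x y : \bar R, eval_binop oacc x y = op x y.
Hypothesis evallit : forall env M, eval env M lit = idx.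
Hypothesis costlit : expr_cost lit = 0.

Lemma exec_add_terms env e s T d (f : nat -> \bar R) :
  (forall r M, r < sz d -> (forall a js, a != T -> M a js = cells s a js) ->
     eval (upd env 3 r) M e = f r) ->
  let t := exec sz env (add_terms oacc T d e) s in
  writes_only (fun a js => (a == T) && (js == [:: env 1; env 2]))
    (sz d * (expr_cost e).+1) s t /\
  cells t T [:: env 1; env 2] =
    op (cells s T [:: env 1; env 2]) (\big[op/idx]_(0 <= r < sz d) f r).
Proof.
move=> he.
pose js0 := [:: env 1; env 2].
apply: (foldl_iota_ind (I := fun r t =>
  writes_only (fun a js => (a == T) && (js == js0)) (r * (expr_cost e).+1) s t /\
  cells t T js0 = op (cells s T js0) (\big[op/idx]_(0 <= q < r) f q))).
  by rewrite big_geq // Monoid.mulm1; split=> //; exact: writes_only_refl.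
move=> r t ltrd [wt ht]; split.
  rewrite mulSn addnC; apply: (writes_only_trans wt); split=> //= a js.
  by rewrite /write => /negbTE ->.
rewrite /= /write !eqxx evalacc big_nat_recr //= Monoid.mulmA -/js0 ht; congr (op _ _).
apply: he => // a js neq; case: wt => h _ _; apply: h.
by rewrite (negbTE neq).
Qed.

Lemma exec_fill env s T :
  let t := exec sz env (entry_loop (CAssign T [:: 1; 2] lit)) s in
  writes_only (fun a _ => a == T) 0 s t /\
  (forall i j, i < sz DimM -> j < sz DimN -> cells t T [:: i; j] = idx).
Proof.
have := @exec_entry_loop env (CAssign T [:: 1; 2] lit) s T 0 (fun _ _ _ => idx).
rewrite muln0; apply=> i j t ltiM ltjN _ /=; split.
  by split=> [a js|//|]; rewrite /= ?costlit // /write => /negbTE ->.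
by rewrite /= /write !eqxx evallit.
Qed.

Lemma exec_add_terms_entries env e s T d (f : nat -> nat -> nat -> \bar R) :
  (forall i j r M, i < sz DimM -> j < sz DimN -> r < sz d ->
     (forall a js, a != T -> M a js = cells s a js) ->
     eval (upd (upd (upd env 1 i) 2 j) 3 r) M e = f i j r) ->
  let t := exec sz env (entry_loop (add_terms oacc T d e)) s in
  writes_only (fun a _ => a == T)
    (sz DimM * sz DimN * (sz d * (expr_cost e).+1)) s t /\
  (forall i j, i < sz DimM -> j < sz DimN ->
     cells t T [:: i; j] =
     op (cells s T [:: i; j]) (\big[op/idx]_(0 <= r < sz d) f i j r)).
Proof.
move=> he; apply: (exec_entry_loop
  (g := fun i j x => op x (\big[op/idx]_(0 <= r < sz d) f i j r))).
move=> i j t ltiM ltjN agree.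
apply: (exec_add_terms (env := upd (upd env 1 i) 2 j)) => r M ltrd agreeM.
by apply: he => // a js neq; rewrite agreeM // agree.
Qed.

(** The factors are given by the values l and r that the expressions take in every
    memory that agrees with the initial one outside the two arrays written. *)
Lemma exec_triple_sum env el mid er dst s (l r : nat -> nat -> nat -> \bar R) :
  dst != 4 -> mid \notin [:: 4; dst] ->
  (forall env M, (forall a js, a \notin [:: 4; dst] -> M a js = cells s a js) ->
     eval env M el = l (env 0) (env 1) (env 3)) ->
  (forall env M, (forall a js, a \notin [:: 4; dst] -> M a js = cells s a js) ->
     eval env M er = r (env 0) (env 3) (env 2)) ->
  let t := exec sz env (triple_sum oacc omul lit el mid er dst) s in
  writes_only (fun a _ => a \in [:: 4; dst])
    (sz DimP * (sz DimM * sz DimN *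
       (sz DimM * (expr_cost el).+2 + sz DimN * (expr_cost er).+2))) s t /\
  (forall i j, i < sz DimM -> j < sz DimN ->
     cells t dst [:: i; j] =
     \big[op/idx]_(0 <= k < sz DimP) \big[op/idx]_(0 <= b < sz DimN)
       eval_binop omul
         (\big[op/idx]_(0 <= a < sz DimM)
            eval_binop omul (l k i a) (cells s mid [:: a; b]))
         (r k b j)).
Proof.
move=> dst4 midF hel her.
set c := sz DimM * sz DimN * _.
pose V k i j := \big[op/idx]_(0 <= b < sz DimN)
  eval_binop omul (\big[op/idx]_(0 <= a < sz DimM)
    eval_binop omul (l k i a) (cells s mid [:: a; b])) (r k b j).
pose D (a : nat) (_ : seq nat) := a \in [:: 4; dst].
have D4 a js : (a == 4) -> D a js by move=> /eqP->; rewrite /D mem_head.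
have Dd a js : (a == dst) -> D a js by move=> /eqP->; rewrite /D !inE eqxx orbT.
apply: (foldl_iota_ind (I := fun k t => writes_only D (k * c) s t /\
  (forall i j, i < sz DimM -> j < sz DimN ->
     cells t dst [:: i; j] = \big[op/idx]_(0 <= q < k) V q i j))).
  have [w h] := exec_fill env s dst; split; first exact: writes_only_sub w.
  by move=> i j ltiM ltjN; rewrite h // big_geq.
move=> k t ltkP [wt ht].
set envk := upd env 0 k.
(* t1, t2 and t3 are the states after clearing the work array, after the first
   product and after the second one. *)
have [w1 h1] := exec_fill envk t 4.
set t1 := exec sz envk _ t in w1 h1.
have w1s := writes_only_trans wt (writes_only_sub D4 w1).
have agree1 a js : a \notin [:: 4; dst] -> cells t1 a js = cells s a js.
  by case: w1s => h _ _; exact: h.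
have agree1M M : (forall a js, a != 4 -> M a js = cells t1 a js) ->
    forall a js, a \notin [:: 4; dst] -> M a js = cells s a js.
  move=> hM a js aF; rewrite hM ?agree1 //.
  by apply: contra aF; exact: (D4 a js).
have [|w2 h2] := @exec_add_terms_entries envk
  (EBin omul el (ECell mid [:: 3; 2])) t1 4 DimM
  (fun i j a => eval_binop omul (l k i a) (cells s mid [:: a; j])).
  move=> i j a M _ _ _ hM /=.
  by rewrite (hel _ M (agree1M M hM)) (agree1M M hM).
set t2 := exec sz envk _ t1 in w2 h2.
have w2s := writes_only_trans w1s (writes_only_sub D4 w2).
have agree2M M : (forall a js, a != dst -> M a js = cells t2 a js) ->
    forall a js, a \notin [:: 4; dst] -> M a js = cells s a js.
  move=> hM a js aF; rewrite hM; last by apply: contra aF; exact: (Dd a js).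
  by case: w2s => h _ _; exact: h.
have [|w3 h3] := @exec_add_terms_entries envk
  (EBin omul (ECell 4 [:: 1; 3]) er) t2 dst DimN
  (fun i j b => eval_binop omul (\big[op/idx]_(0 <= a < sz DimM)
    eval_binop omul (l k i a) (cells s mid [:: a; b])) (r k b j)).
  move=> i j b M ltiM _ ltbN hM /=.
  rewrite (her _ M (agree2M M hM)) hM 1?eq_sym // h2 // h1 //.
  by rewrite Monoid.mul1m.
set t3 := exec sz envk _ t2 in w3 h3.
have w3s := writes_only_trans w2s (writes_only_sub Dd w3).
rewrite -[X in writes_only _ _ _ X]/t3 -[X in cells X]/t3; split.
  case: w3s => cells3 verdict3 ops3; split=> //; rewrite ops3 /c /=.
  by rewrite mulSnr addn0 -[in LHS]addnA -mulnDr !addn0 add0n.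
move=> i j ltiM ltjN; rewrite h3 // big_nat_recr //=; congr (op _ _).
rewrite -ht //; case: w2 => -> //; case: w1 => -> //.
Qed.

End Semiring.

(** Equality is tested by two inequalities; the second test is skipped when the
    first fails, so that only an upper bound on the cost holds. *)
Lemma exec_compare_arrays env a b s :
  let t := exec sz env (compare_arrays a b) s in
  [/\ cells t = cells s,
      verdict t = true <-> (forall i j, i < sz DimM -> j < sz DimN ->
        cells s a [:: i; j] = cells s b [:: i; j])
    & ops t <= ops s + sz DimM * sz DimN * 2].
Proof.
pose body := CIfLe (ECell a [:: 1; 2]) (ECell b [:: 1; 2])
  (CIfLe (ECell b [:: 1; 2]) (ECell a [:: 1; 2]) CSkip (CVerdict false))
  (CVerdict false).
pose Inv i j t := [/\ cells t = cells s,
  verdict t = true <-> (forall i' j', i' < sz DimM -> j' < sz DimN ->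
     (i' < i) || ((i' == i) && (j' < j)) ->
     cells s a [:: i'; j'] = cells s b [:: i'; j'])
  & ops t <= ops s + (i * sz DimN + j) * 2].
suff [ct vt ot] : Inv (sz DimM) 0 (exec sz env (compare_arrays a b) s).
  split=> //; last by rewrite addn0 in ot.
  rewrite vt; split=> h i j ltiM ltjN; first by apply: h => //; rewrite ltiM.
  by move=> _; exact: h.
apply: (foldl_iota_ind (I := fun i t => Inv i 0 t)).
  split=> /=; [by []| |by rewrite !mul0n addn0].
  by split=> // _ i' j' _ _; rewrite !ltn0 andbF.
move=> i t ltiM It.
suff [cu vu ou] : Inv i (sz DimN) (exec sz (upd env 1 i) (CFor 2 DimN body) t).
  split=> //; last by rewrite addn0 mulSnr.
  rewrite -/(exec sz (upd env 1 i) (CFor 2 DimN body) t) vu.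
  split=> h i' j' lti ltj; rewrite ?ltn0 ?andbF ?orbF => lei; apply: h => //.
    by move: lei; rewrite ltj andbT orbC -leq_eqVlt.
  by move: lei; rewrite ltnS ltn0 andbF orbF ltj andbT orbC -leq_eqVlt.
apply: (foldl_iota_ind (I := fun j t => Inv i j t)) => // j u ltjN [cu vu ou].
have [cv vv ov] : let v := exec sz (upd (upd env 1 i) 2 j) body u in
   [/\ cells v = cells u,
       verdict v = verdict u && (cells s a [:: i; j] == cells s b [:: i; j])
     & ops v <= ops u + 2].
  rewrite /= /upd /= cu eq_le.
  case: ifP => /= _; last by split; rewrite ?andbF //= leq_add2l.
  rewrite cu; case: ifP => /= _; split; rewrite ?andbT ?andbF // -addnA //.
split=> //; first by rewrite cv.
  rewrite vv; split=> [/andP[/vu h /eqP e] i' j' lti ltj|h].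
    rewrite ltnS [j' <= j]leq_eqVlt andb_orr orbCA => /orP[/andP[/eqP-> /eqP->]//|].
    exact: h.
  apply/andP; split.
    apply/vu => i' j' lti ltj hlt; apply: h => //.
    by case/orP: hlt => [->//|/andP[-> /ltnW]]; rewrite ltnS => ->; rewrite orbT.
  by apply/eqP/h => //; rewrite eqxx ltnSn orbT.
by rewrite addnS mulSn addnCA addnC (leq_trans ov) // leq_add2r.
Qed.

End Programs.

(** * Correctness and cost *)

Section Correctness.
Context {R : realType} {m n p : nat}.
Variables (A : 'I_p -> 'M[\bar R]_m) (B : 'I_p -> 'M[\bar R]_n).
Variable C : 'M[\bar R]_(m, n).
Variable M : @memory R.
Hypothesis inputM : holds_input A B C M.

Lemma run_sylvester_algorithm :
  let t := run m n p sylvester_algorithm M in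
  [/\ holds_output (sylvester_residual A B C) (cells t),
      verdict t = true <->
        sylvester_op A B (sylvester_residual A B C) = C
    & ops t <= p * (m * n * (m * 3 + n * 3)) + p * (m * n * (m * 2 + n * 2)) +
               m * n * 2].
Proof.
case: inputM => hA hB hC.
set X := sylvester_residual A B C.
set s := State M false 0.
pose env0 := fun _ : nat => 0.
pose sz := size_of m n p.
have [| | | |w1 h1] := @exec_triple_sum R sz +oo%E mine OMin OAdd' EPinfty
  (fun _ _ => erefl) (fun _ _ => erefl) erefl
  env0 (EOpp (ECell 0 [:: 0; 3; 1])) 2 (EOpp (ECell 1 [:: 0; 2; 3])) 3 s
  (fun k i a => - (M 0 [:: k; a; i])%N)%E (fun k b j => - (M 1 [:: k; j; b])%N)%E => //.
- by move=> env M' h /=; rewrite h.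
- by move=> env M' h /=; rewrite h.
set t1 := exec sz env0 _ s in w1 h1.
have t1X (i : 'I_m) (j : 'I_n) : cells t1 3 [:: val i; val j] = X i j.
  rewrite h1 ?ltn_ord // mxE big_mkord; apply: eq_bigr => k _.
  rewrite mxE big_mkord; apply: eq_bigr => b _.
  rewrite !mxE big_mkord; congr (otimes' _ _); last by rewrite -hB.
  by apply: eq_bigr => a _; rewrite mxE -hA -hC.
have t1M a js : a \notin [:: 4; 3] -> cells t1 a js = M a js.
  by case: w1 => h _ _; exact: h.
have [| | | |w2 h2] := @exec_triple_sum R sz -oo%E maxe OMax OAdd ENinfty
  (fun _ _ => erefl) (fun _ _ => erefl) erefl
  env0 (ECell 0 [:: 0; 1; 3]) 3 (ECell 1 [:: 0; 3; 2]) 5 t1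
  (fun k i a => M 0 [:: k; i; a]) (fun k b j => M 1 [:: k; b; j]) => //.
- by move=> env M' h /=; rewrite h // t1M.
- by move=> env M' h /=; rewrite h // t1M.
set t2 := exec sz env0 _ t1 in w2 h2.
have t2Y (i : 'I_m) (j : 'I_n) :
    cells t2 5 [:: val i; val j] = sylvester_op A B X i j.
  rewrite h2 ?ltn_ord // mxE big_mkord; apply: eq_bigr => k _.
  rewrite mxE big_mkord; apply: eq_bigr => b _.
  rewrite mxE big_mkord -hB; congr (otimes _ _).
  by apply: eq_bigr => a _; rewrite -hA t1X.
have t2t1 a js : a \notin [:: 4; 5] -> cells t2 a js = cells t1 a js.
  by case: w2 => h _ _; exact: h.
have t2C (i : 'I_m) (j : 'I_n) : cells t2 2 [:: val i; val j] = C i j.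
  by rewrite t2t1 // t1M // -hC.
have [c3 v3 o3] := exec_compare_arrays sz env0 5 2 t2.
have -> : run m n p sylvester_algorithm M =
  exec sz env0 (compare_arrays 5 2) t2 by [].
split.
- by move=> i j; rewrite c3 t2t1 //= t1X.
- rewrite v3; split=> [h|h i j ltim ltjn].
    by apply/matrixP => i j; rewrite -t2Y -t2C; apply: h; exact: ltn_ord.
  by rewrite (t2Y (Ordinal ltim) (Ordinal ltjn)) (t2C (Ordinal ltim) (Ordinal ltjn)) h.
apply: leq_trans o3 _; rewrite leq_add2r.
by case: w2 => _ _ ->; case: w1 => _ _ ->.
Qed.

End Correctness.

(** In the first triple sum each term costs an addition, a minimum and a negation,
    in the second an addition and a maximum, and the comparison costs at most two
    operations per entry; the latter is absorbed because 1 <= m p. *)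
Lemma sylvester_cost_bound m n p : 1 <= m -> 1 <= p ->
  p * (m * n * (m * 3 + n * 3)) + p * (m * n * (m * 2 + n * 2)) + m * n * 2 <=
  7 * (p * (m ^ 2 * n + m * n ^ 2)).
Proof.
move=> m1 p1.
have le_mn : m * n <= p * (m * n * m).
  by rewrite -[leqLHS]mul1n leq_mul // leq_pmulr.
suff -> : 7 * (p * (m ^ 2 * n + m * n ^ 2)) =
    p * (m * n * (m * 3 + n * 3)) + p * (m * n * (m * 2 + n * 2)) +
    p * (m * n * m) * 2 + p * (m * n * n) * 2.
  by apply: leq_trans (leq_addr _ _); rewrite leq_add2l leq_mul2r.
nia.
Qed.

Theorem theorem3p2 (R : realType) :
  (forall (m n p : nat) (hm : (1 <= m)%N) (hn : (1 <= n)%N) (hp : (1 <= p)%N)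
      (A : 'I_p -> 'M[\bar R]_m) (B : 'I_p -> 'M[\bar R]_n)
      (C : 'M[\bar R]_(m, n))
      (hA : forall k, Rmax_mx (A k)) (hB : forall k, Rmax_mx (B k))
      (hC : Rmax_mx C),
      sylvester_principal A B C =
        bigoplus' (fun k => (A k)^♯ ⊗' C ⊗' (B k)^♯)
      /\ (sylvester_solvable A B C <->
          sylvester_eq A B C (sylvester_principal A B C)))
  /\
  (exists (alg : cmd) (K : nat),
    forall (m n p : nat) (hm : (1 <= m)%N) (hn : (1 <= n)%N) (hp : (1 <= p)%N)
      (A : 'I_p -> 'M[\bar R]_m) (B : 'I_p -> 'M[\bar R]_n)
      (C : 'M[\bar R]_(m, n))
      (hA : forall k, Rmax_mx (A k)) (hB : forall k, Rmax_mx (B k))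
      (hC : Rmax_mx C)
      (M : @memory R) (hM : holds_input A B C M),
      [/\ holds_output (sylvester_principal A B C) (cells (run m n p alg M)),
          verdict (run m n p alg M) = true <->
            sylvester_eq A B C (sylvester_principal A B C)
        & (ops (run m n p alg M) <= K * (p * (m ^ 2 * n + m * n ^ 2)))%N]).
Proof.
split=> [m n p _ _ _ A B C _ _ finC|].
  by split; [exact: sylvester_principalE|exact: sylvester_solvableP].
exists sylvester_algorithm, 7 => m n p m1 _ p1 A B C _ _ _ M inputM.
have [out ver cost] := run_sylvester_algorithm inputM.
rewrite sylvester_principalE; split=> //.
exact: leq_trans cost (sylvester_cost_bound n m1 p1).
Qed.
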